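(* Fix $\gamma>0$ and let $(\mathcal{E},\mathcal{F})$ be the Dirichlet form on $L^2(\mathbf{R}^3,m)$ defined in the context. The $1$-capacity of the set $\{0\}$ with respect to $(\mathcal{E},\mathcal{F})$ is positive: $\mathrm{Cap}(\{0\})>0$.
   Context: Let $\psi_\gamma(x)=\frac{\sqrt{\gamma}}{\sqrt{2\pi}}\frac{e^{-\gamma|x|}}{|x|}$, $m(dx)=\psi_\gamma(x)^2dx$ on $\mathbf{R}^3$, $\mathcal{F}=\{u\in L^2(\mathbf{R}^3,m):\nabla u\in L^2(\mathbf{R}^3,m)\}$ (distributional gradient), and $\mathcal{E}(u,v)=\frac12\int_{\mathbf{R}^3}\nabla u\cdot\nabla v\,dm$ for $u,v\in\mathcal{F}$. This is a regular Dirichlet form on $L^2(\mathbf{R}^3,m)$ with core $C_c^\infty(\mathbf{R}^3)$. Put $\mathcal{E}_1(u,u)=\mathcal{E}(u,u)+\int u^2dm$. The $1$-capacity of an open set $G$ is $\mathrm{Cap}(G)=\inf\{\mathcal{E}_1(u,u):u\in\mathcal{F},\,u\ge1\ m\text{-a.e. on }G\}$ (with $\inf\emptyset=\infty$), and for an arbitrary set $B$, $\mathrm{Cap}(B)=\inf\{\mathrm{Cap}(G):G\supset B\text{ open}\}$. *)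

(* Defs.v *)
From HB Require Import structures.
From mathcomp Require Import all_boot all_order all_algebra.
From mathcomp Require Import all_classical all_reals all_analysis.
From mathcomp Require Import measurable_realfun.

Set Implicit Arguments.
Unset Strict Implicit.
Unset Printing Implicit Defensive.

Import Order.TTheory GRing.Theory Num.Theory.
Import numFieldNormedType.Exports.

Local Open Scope classical_set_scope.
Local Open Scope ring_scope.

(* [measurableTypeR R], convertible to [R], is the carrier on which
   [lebesgue_measure] is defined.  The topology on the product is the Euclidean
   one and the sigma-algebra the Borel one, but the norm is the sup norm, hence
   the separate [enorm]. *)
Notation R3 R := (measurableTypeR R * measurableTypeR R * measurableTypeR R)%type.

Definition basis3 (R : realType) (i : 'I_3) : R3 R :=
  ((i == 0 :> nat)%:R, (i == 1 :> nat)%:R, (i == 2 :> nat)%:R).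

Definition enorm (R : realType) (x : R3 R) : R :=
  Num.sqrt (x.1.1 ^+ 2 + x.1.2 ^+ 2 + x.2 ^+ 2).

Definition leb3 (R : realType) : set (R3 R) -> \bar R :=
  ((@lebesgue_measure R \x @lebesgue_measure R) \x @lebesgue_measure R)%E.

Arguments leb3 : clear implicits.
HB.instance Definition _ (R : realType) := Measure.on (leb3 R).

(* At the origin [_ / 0 = 0] gives [psi gamma 0 = 0]; the origin is
   Lebesgue-null, so the measure [m3] below does not see this value. *)
Definition psi (R : realType) (gamma : R) (x : R3 R) : R :=
  Num.sqrt gamma / Num.sqrt (2 * pi) * (expR (- gamma * enorm x) / enorm x).

Definition m3 (R : realType) (gamma : R) (A : set (R3 R)) : \bar R :=
  (\int[leb3 R]_(x in A) ((psi gamma x) ^+ 2)%:E)%E.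

Lemma enorm_ge0 (R : realType) (x : R3 R) : 0 <= enorm x.
Proof. exact: sqrtr_ge0. Qed.

Lemma measurable_enorm (R : realType) :
  measurable_fun [set: R3 R] (@enorm R).
Proof.
have -> : @enorm R =
    (fun t : R => t `^ 2^-1) \o (fun x => x.1.1 ^+ 2 + x.1.2 ^+ 2 + x.2 ^+ 2).
  apply/funext => x; rewrite /= powR12_sqrt//.
  by rewrite !addr_ge0// sqr_ge0.
apply: measurableT_comp; first exact: measurable_powR.
have m1 : measurable_fun [set: R3 R] (fst : R3 R -> measurableTypeR R * measurableTypeR R)
  by exact: measurable_fst.
apply: measurable_funD; first apply: measurable_funD.
- by apply: measurable_funX; exact: measurableT_comp measurable_fst m1.
- by apply: measurable_funX; exact: measurableT_comp measurable_snd m1.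
- by apply: measurable_funX; exact: measurable_snd.
Qed.

Lemma measurable_psi (R : realType) (gamma : R) :
  measurable_fun [set: R3 R] (psi gamma).
Proof.
apply: measurable_funM; first exact: measurable_cst.
apply: measurable_funM.
  apply: measurableT_comp; first exact: measurable_expR.
  by apply: measurable_funM; [exact: measurable_cst|exact: measurable_enorm].
have -> : (fun x => (@enorm R x)^-1) = (fun t => t `^ (-1)) \o @enorm R.
  by apply/funext => x /=; rewrite powR_inv1// enorm_ge0.
apply: measurableT_comp; first exact: measurable_powR.
exact: measurable_enorm.
Qed.

Section m3_measure.
Context {R : realType} (gamma : R).

Let m3_0 : m3 gamma set0 = 0%E.
Proof. by rewrite /m3 integral_set0. Qed.

Let m3_ge0 A : (0 <= m3 gamma A)%E.
Proof. by apply: integral_ge0 => x _; rewrite lee_fin sqr_ge0. Qed.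

Let m3_sigma_additive : semi_sigma_additive (m3 gamma).
Proof.
move=> /= F mF tF mUF; rewrite /m3; apply: cvg_toP.
  apply: ereal_nondecreasing_is_cvgn => m n mn.
  apply: lee_sum_nneg_natr => // k _ _; apply: integral_ge0 => /= x Fkx.
  by rewrite lee_fin sqr_ge0.
rewrite ge0_integral_bigcup//=.
- apply/measurable_funTS/measurableT_comp => //.
  by apply: measurable_funX; exact: measurable_psi.
- by move=> x _; rewrite lee_fin sqr_ge0.
Qed.

HB.instance Definition _ := isMeasure.Build _ _ _
  (m3 gamma) m3_0 m3_ge0 m3_sigma_additive.

End m3_measure.

(* [pderivs [:: i1; ..; ik] f] is the iterated partial derivative
   d_i1 (.. (d_ik f)). *)
Definition pderivs (R : realType) (s : seq 'I_3) (f : R3 R -> R) : R3 R -> R :=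
  foldr (fun i g => 'D_(basis3 R i) g) f s.

Definition smooth (R : realType) (f : R3 R -> R) : Prop :=
  forall s : seq 'I_3, continuous (pderivs s f) /\
    forall (x : R3 R) (i : 'I_3), derivable (pderivs s f) x (basis3 R i).

Definition test_function (R : realType) (phi : R3 R -> R) : Prop :=
  smooth phi /\ compact (closure [set x | phi x != 0]).

Definition locally_integrable3 (R : realType) (f : R3 R -> R) : Prop :=
  measurable_fun [set: R3 R] f /\
  forall K : set (R3 R), compact K -> (leb3 R).-integrable K (EFin \o f).

Definition is_weak_gradient (R : realType) (u : R3 R -> R)
    (g : 'I_3 -> R3 R -> R) : Prop :=
  [/\ locally_integrable3 u,
      forall i, locally_integrable3 (g i) &
      forall (phi : R3 R -> R) (i : 'I_3), test_function phi ->
        \int[leb3 R]_x (u x * 'D_(basis3 R i) phi x) =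
        - \int[leb3 R]_x (g i x * phi x)].

Definition weakly_differentiable (R : realType) (u : R3 R -> R) : Prop :=
  exists g, is_weak_gradient u g.

(* The weak gradient is unique up to a Lebesgue-null set; [wgrad u] is one
   representative, and 0 when [u] has no weak gradient. *)
Definition wgrad (R : realType) (u : R3 R -> R) : 'I_3 -> R3 R -> R :=
  xget (fun=> cst 0) [set g | is_weak_gradient u g].

(* Elements of L^2(m) are represented by Borel functions.  They are locally
   integrable, since [psi gamma] is bounded below by a positive constant on
   bounded sets (up to the origin), so their distributional gradient makes sense. *)
Definition domF (R : realType) (gamma : R) : set (R3 R -> R) :=
  [set u | [/\ u \in Lfun (m3 gamma) 2%:E,
               weakly_differentiable u &
               forall i, wgrad u i \in Lfun (m3 gamma) 2%:E]].

Definition formE (R : realType) (gamma : R) (u v : R3 R -> R) : R :=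
  2^-1 * \int[m3 gamma]_x (\sum_(i < 3) wgrad u i x * wgrad v i x).

Definition formE1 (R : realType) (gamma : R) (u v : R3 R -> R) : R :=
  formE gamma u v + \int[m3 gamma]_x (u x * v x).

Definition cap_open (R : realType) (gamma : R) (G : set (R3 R)) : \bar R :=
  ereal_inf [set (formE1 gamma u u)%:E | u in
    [set u | domF gamma u /\ {ae m3 gamma, forall x, G x -> 1 <= u x}]].

Definition Cap (R : realType) (gamma : R) (B : set (R3 R)) : \bar R :=
  ereal_inf [set cap_open gamma G | G in
    [set G : set (R3 R) | open G /\ B `<=` G]].

(* Main.v *)
Require Import Defs.
From HB Require Import structures.
From mathcomp Require Import all_boot all_order all_algebra.
From mathcomp Require Import all_classical all_reals all_analysis.
From mathcomp Require Import measurable_realfun ring lra.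

Import Order.TTheory GRing.Theory Num.Theory.
Import numFieldNormedType.Exports.

Local Open Scope classical_set_scope.
Local Open Scope ring_scope.

(** Along a ray the density of m is exp(-2 gamma r) / r^2, and the factor 1/r^2
    cancels the Jacobian r^2 of polar coordinates: radially, the form behaves
    like a one-dimensional one, for which points have positive capacity. In
    terms of test functions, the field x/|x|^3, whose divergence is a multiple
    of the Dirac mass at 0, has size 1/|x|^2, comparable with the density of m,
    and the constant 1 is in L^2(m) near 0. Integration by parts against a
    truncation of this field hence bounds the average of u over an arbitrarily
    small neighbourhood of 0 by the norm of u in E_1. If u >= 1 on a
    neighbourhood of 0 this average is bounded below, so E_1(u,u) cannot be
    small.

    The field is replaced here by a dyadic version built from functions of one
    variable. Let F be a smooth step, b = F', and
    rho_k(x) = b_k(x_1) b_k(x_2) b_k(x_3) with b_k(s) = 4^k b(4^k s). Since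
    b_k - b_(k+1) is the derivative of F(4^k s) - F(4^(k+1) s), which has
    compact support, rho_k - rho_(k+1) is the divergence of an explicit test
    field, of size at most L 16^k and supported in the cube Q_k of half-side
    4^-k (derive_flux, flux_le). Off the origin, the density of m is at least
    c^2 16^k on Q_k (leb3_le_m3), so Young's inequality gives, for every lambda > 0,
    a bound L (lambda c^-2 |w|^2 + 8 4^-k / lambda) on the pairing of
    w in L^2(m) with a component of this field (L2_pairing). With
    lambda = Lambda 2^-k these bounds form a geometric series, and telescoping
    over k < N bounds the integral of u rho_N by
    L (Lambda c^-2 (|u|^2 + 2 |grad u|^2) + 56 / Lambda), uniformly in N
    (mollified_value_bound). If u >= 1 on an open set containing 0, that set contains
    some Q_N, and the integral of u rho_N is at least a constant c0 > 0 that
    depends neither on N nor on u (mollified_value_ge). Taking Lambda large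
    enough gives a lower bound for E_1(u,u) (formE1_lower_bound). *)

(** * Smooth functions of one real variable *)

(** Recursion on the order of differentiability makes closure under sums,
    products and composition a plain induction, with no Leibniz or Faa di Bruno
    formula. *)
Fixpoint smooth_upto {R : realType} (n : nat) (f : R -> R) : Prop :=
  if n is n'.+1 then (forall x, derivable f x 1) /\ smooth_upto n' f^`()%classic
  else True.

Lemma smooth_uptoS {R : realType} n (f g : R -> R) :
  (forall x, is_derive x (1:R) f (g x)) -> smooth_upto n g -> smooth_upto n.+1 f.
Proof.
move=> fg sg; split=> [x|]; first by have [] := fg x.
suff -> : f^`()%classic = g by [].
by apply/funext => x; rewrite derive1E; have [_ ->] := fg x.
Qed.

Lemma smooth_uptoW {R : realType} n (f : R -> R) :
  smooth_upto n.+1 f -> smooth_upto n f.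
Proof.
elim: n f => //= n IH f [df [ddf sf]]; split=> //.
exact: IH.
Qed.

Lemma smooth_upto_derive1 {R : realType} n (f : R -> R) x :
  smooth_upto n.+1 f -> is_derive x (1:R) f (f^`()%classic x).
Proof. by move=> [df _]; rewrite derive1E; exact/derivableP. Qed.

Lemma smooth_uptoD {R : realType} n (f g : R -> R) :
  smooth_upto n f -> smooth_upto n g -> smooth_upto n (fun x => f x + g x).
Proof.
elim: n f g => // n IH f g sf sg.
apply: (@smooth_uptoS _ _ _ (fun x => f^`()%classic x + g^`()%classic x)).
  move=> x; apply: is_deriveD.
  - exact: smooth_upto_derive1 sf.
  - exact: smooth_upto_derive1 sg.
by apply: IH; [case: sf|case: sg].
Qed.

(** The product rule involves f and g themselves besides their derivatives,
    hence the weakening smooth_uptoW. *)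
Lemma smooth_uptoM {R : realType} n (f g : R -> R) :
  smooth_upto n f -> smooth_upto n g -> smooth_upto n (fun x => f x * g x).
Proof.
elim: n f g => // n IH f g sf sg.
apply: (@smooth_uptoS _ _ _
  (fun x => f x * g^`()%classic x + g x * f^`()%classic x)).
  move=> x; apply: is_derive_eq; first apply: is_deriveM.
  - exact: smooth_upto_derive1 sf.
  - exact: smooth_upto_derive1 sg.
  - by [].
by apply: smooth_uptoD; apply: IH;
  by [case: sg|case: sf|exact: smooth_uptoW].
Qed.

Lemma smooth_upto_cst {R : realType} n (c : R) : smooth_upto n (cst c).
Proof.
elim: n c => // n IH c.
by apply: (@smooth_uptoS _ _ _ (cst 0)).
Qed.

Lemma smooth_upto_id {R : realType} n : smooth_upto n (@id R).
Proof.
case: n => // n; apply: (@smooth_uptoS _ _ _ (cst 1)).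
exact: smooth_upto_cst.
Qed.

Lemma smooth_upto_comp {R : realType} n (f g : R -> R) :
  smooth_upto n f -> smooth_upto n g -> smooth_upto n (fun x => f (g x)).
Proof.
elim: n f g => // n IH f g sf sg.
apply: (@smooth_uptoS _ _ _ (fun x => f^`()%classic (g x) * g^`()%classic x)).
  move=> x; apply: is_derive1_comp.
  - exact: smooth_upto_derive1 sf.
  - exact: smooth_upto_derive1 sg.
apply: smooth_uptoM; last by case: sg.
by apply: IH; [case: sf|exact: smooth_uptoW].
Qed.

Definition smooth1 {R : realType} (f : R -> R) := forall n, smooth_upto n f.

(** * The flat functions p(1/x) exp(-1/x) *)

Lemma powX_le_expR {R : realType} n (y : R) : 0 <= y -> y ^+ n <= n`!%:R * expR y.
Proof.
case: n => [|n] y0; first by rewrite expr0 fact0 mul1r -expR0 ler_expR.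
have := expR_ge1Dxn n y0.
rewrite -ler_pdivrMl ?ltr0n ?fact_gt0// mulrC.
by apply: le_trans; rewrite lerDr.
Qed.

(** Growth of the exponential beats every polynomial; this is what flattens the
    functions below at the origin. *)
Lemma horner_le_expR {R : realType} (p : {poly R}) :
  exists2 C, 0 <= C & forall y, 0 <= y -> `|p.[y]| <= C * expR y.
Proof.
exists (\sum_(i < size p) `|p`_i| * i`!%:R).
  by apply: sumr_ge0 => i _; rewrite mulr_ge0.
move=> y y0; rewrite horner_coef (le_trans (ler_norm_sum _ _ _))// mulr_suml.
apply: ler_sum => i _; rewrite normrM -mulrA ler_wpM2l//.
by rewrite ger0_norm ?exprn_ge0// powX_le_expR.
Qed.

(** This class of functions is stable under differentiation: the derivative of
    p(1/x) exp(-1/x) is q(1/x) exp(-1/x) with q = X^2 (p - p'). *)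
Definition flat {R : realType} (p : {poly R}) (x : R) : R :=
  if 0 < x then p.[x^-1] * expR (- x^-1) else 0.

(** Makes the difference quotients at 0 tend to 0: apply the exponential bound to
    X^2 p at 1/x. *)
Lemma flat_quadratic {R : realType} (p : {poly R}) :
  exists2 C, 0 <= C & forall x, `|flat p x| <= C * x ^+ 2.
Proof.
have [C C0 HC] := horner_le_expR ('X^2 * p).
exists C => // x; rewrite /flat; case: ifPn => [x0|_]; last first.
  by rewrite normr0 mulr_ge0// sqr_ge0.
have := HC x^-1; rewrite invr_ge0 ltW// => /(_ isT).
rewrite hornerM hornerXn normrM exprVn (ger0_norm (_ : 0 <= (x^+2)^-1)); last first.
  by rewrite invr_ge0 sqr_ge0.
rewrite ler_pdivrMl ?exprn_gt0// => H.
rewrite normrM [X in _ * X]ger0_norm ?expR_ge0// expRN.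
by rewrite ler_pdivrMr ?expR_gt0// (le_trans H)// mulrA [x^+2 * C]mulrC.
Qed.

Lemma is_derive_flat {R : realType} (p : {poly R}) (x : R) :
  is_derive x (1:R) (flat p) (flat ('X^2 * (p - p^`())) x).
Proof.
have [x0|x0|->] := ltgtP x 0.
- rewrite {2}/flat ltNge (ltW x0)/=.
  apply: (@near_eq_is_derive _ _ _ (cst 0)) => //.
  near=> y; rewrite /flat ifF//; apply/negbTE; rewrite -leNgt ltW//.
  near: y; exact: lt_nbhsl.
- rewrite {2}/flat x0.
  apply: (@near_eq_is_derive R R R (fun y : R => p.[y^-1] * expR (- y^-1))).
  + near=> y; rewrite /flat ifT//.
    by near: y; exact: lt_nbhsr.
  + have xn0 : x != 0 by rewrite gt_eqF.
    have dV : is_derive x (1:R) (fun y : R => y^-1) (- (x ^- 2)).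
      apply: is_derive_eq; first exact: is_deriveV.
      by rewrite /GRing.scale/= mulr1.
    have d1 := is_derive1_comp (is_derive_poly p x^-1) dV.
    have dN : is_derive x (1:R) (fun y : R => - y^-1) (x ^- 2).
      by have := is_deriveN dV; rewrite opprK.
    have d2 := @is_derive1_comp R expR (fun y : R => - y^-1) _ _ _
      (is_derive_expR _) dN.
    have d := is_deriveM d1 d2.
    apply: (@is_derive_eq _ _ _ _ _ _ _ _ d).
    rewrite hornerM hornerXn hornerD hornerN exprVn.
    change (p.[x^-1] * (expR (- x^-1) / x ^+ 2) +
      expR (- x^-1) * (p^`().[x^-1] * - x ^- 2) =
      x ^- 2 * (p.[x^-1] - p^`().[x^-1]) * expR (- x^-1)).
    by ring.
(* At 0 the difference quotient is at most C |h|. *)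
- have [C C0 HC] := flat_quadratic p.
  rewrite {2}/flat ltxx.
  have f0 : flat p 0 = 0 by rewrite /flat ltxx.
  have cv : (fun h : R => h^-1 *: (flat p (h *: (1:R) + 0) - flat p 0)) @ 0^' --> (0:R).
    apply/cvgrPdist_le => e e0.
    near=> h.
    have hn0 : h != 0 by near: h; exact: nbhs_dnbhs_neq.
    rewrite f0 subr0 addr0 sub0r normrN /GRing.scale/= mulr1 normrM normrV ?unitfE//.
    rewrite ler_pdivrMl ?normr_gt0//.
    apply: (le_trans (HC h)).
    rewrite -[h ^+ 2]ger0_norm ?sqr_ge0// normrX expr2 mulrCA ler_wpM2l//.
    have : `|h| <= e / (C + 1).
      near: h; apply: dnbhs0_le; by rewrite divr_gt0// ltr_wpDl.
    rewrite ler_pdivlMr ?ltr_wpDl// => /(le_trans _); apply.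
    by rewrite mulrC ler_wpM2l// lerDl.
  apply: DeriveDef; last by apply/cvg_lim.
  by apply: (cvgP _ cv).
Unshelve. all: by end_near.
Qed.

Lemma smooth_flat {R : realType} (p : {poly R}) : smooth1 (flat p).
Proof.
move=> n; elim: n p => // n IH p.
exact: smooth_uptoS (is_derive_flat p) (IH _).
Qed.

(** * A smooth step and its derivative *)

Lemma flat_ge0 {R : realType} n (x : R) : 0 <= flat 'X^n x.
Proof.
rewrite /flat; case: ifPn => // x0.
by rewrite mulr_ge0 ?expR_ge0// hornerXn exprn_ge0// invr_ge0 ltW.
Qed.

Lemma flat_gt0 {R : realType} n (x : R) : 0 < x -> 0 < flat 'X^n x.
Proof.
by move=> x0; rewrite /flat x0 mulr_gt0 ?expR_gt0// hornerXn exprn_gt0// invr_gt0.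
Qed.

Lemma flat_le0 {R : realType} (p : {poly R}) (x : R) : x <= 0 -> flat p x = 0.
Proof. by move=> x0; rewrite /flat ltNge x0. Qed.

Lemma flat_le {R : realType} n (x : R) : flat 'X^n x <= n`!%:R.
Proof.
rewrite /flat; case: ifPn => // x0.
rewrite hornerXn expRN ler_pdivrMr ?expR_gt0// powX_le_expR//.
by rewrite invr_ge0 ltW.
Qed.

Lemma is_derive_flat1 {R : realType} (x : R) :
  is_derive x (1:R) (flat 'X^0) (flat 'X^2 x).
Proof.
have := is_derive_flat 'X^0 x.
by rewrite expr0 derivC subr0 mulr1.
Qed.

(** Nesting exp(-1/x) in itself gives a step without any integration: the inner
    term is 0 for s >= 1, which makes the step constant there, and the factor
    exp(1/2) makes the outer argument nonpositive for s <= -1. *)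
Definition step {R : realType} (s : R) : R :=
  flat 'X^0 (1 - expR 2^-1 * flat 'X^0 (1 - s)).

Definition spike {R : realType} (s : R) : R :=
  flat 'X^2 (1 - expR 2^-1 * flat 'X^0 (1 - s)) * (expR 2^-1 * flat 'X^2 (1 - s)).

(** The minus signs of the two inner derivatives cancel, so the step is
    nondecreasing: its derivative is a product of nonnegative factors. *)
Lemma is_derive_step {R : realType} (s : R) : is_derive s (1:R) step (spike s).
Proof.
have d1 : is_derive s (1:R) (fun s : R => 1 - s) (- 1).
  by have := is_deriveB (is_derive_cst (1:R) s 1) (is_derive_id s 1); rewrite sub0r.
have d2 := @is_derive1_comp R _ (fun s : R => 1 - s) _ _ _ (is_derive_flat1 _) d1.
have d3 : is_derive s (1:R) (fun s : R => 1 - expR 2^-1 * flat 'X^0 (1 - s))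
    (expR 2^-1 * flat 'X^2 (1 - s)).
  have := is_deriveB (is_derive_cst (1:R) s 1) (is_deriveZ (expR 2^-1) d2).
  by rewrite sub0r mulrN1 scalerN opprK.
exact: (is_derive1_comp (is_derive_flat1 _) d3).
Qed.

Lemma smooth_step {R : realType} : smooth1 (@step R).
Proof.
have sB n (f : R -> R) c : smooth_upto n f -> smooth_upto n (fun s => c - f s).
  move=> sf; have -> : (fun s => c - f s) = (fun s => c + (-1) * f s).
    by apply/funext => s; rewrite mulN1r.
  by apply: smooth_uptoD; [exact: smooth_upto_cst|apply: smooth_uptoM => //;
     exact: smooth_upto_cst].
move=> n; apply: smooth_upto_comp; first exact: smooth_flat.
apply: (sB); apply: smooth_uptoM; first exact: smooth_upto_cst.
apply: smooth_upto_comp; first exact: smooth_flat.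
by apply: sB; exact: smooth_upto_id.
Qed.

Lemma derive1_step {R : realType} : step^`()%classic = @spike R.
Proof. by apply/funext => s; rewrite derive1E; have [_ ->] := is_derive_step s. Qed.

Lemma smooth_spike {R : realType} : smooth1 (@spike R).
Proof. by move=> n; rewrite -derive1_step; have [] := @smooth_step R n.+1. Qed.

Lemma step_ge0 {R : realType} (s : R) : 0 <= step s.
Proof. exact: flat_ge0. Qed.

Lemma step_le1 {R : realType} (s : R) : step s <= 1.
Proof. exact: flat_le. Qed.

Lemma step_arg_le0 {R : realType} (s : R) : s <= -1 ->
  1 - expR 2^-1 * flat 'X^0 (1 - s) <= 0.
Proof.
move=> s1; rewrite subr_le0 /flat ifT; last by lra.
rewrite hornerXn expr0 mul1r -expRD -[leLHS]expR0 ler_expR subr_ge0.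
by rewrite lef_pV2 ?posrE; lra.
Qed.

Lemma step_left {R : realType} (s : R) : s <= -1 -> step s = 0.
Proof. by move=> /step_arg_le0 h; rewrite /step flat_le0. Qed.

Lemma step_right {R : realType} (s : R) : 1 <= s -> step s = step 1.
Proof.
by move=> s1; rewrite /step (@flat_le0 _ _ (1 - s)) ?(@flat_le0 _ _ (1 - 1))//; lra.
Qed.

Lemma spike_ge0 {R : realType} (s : R) : 0 <= spike s.
Proof. by rewrite !mulr_ge0 ?flat_ge0 ?expR_ge0. Qed.

Definition spike_bound (R : realType) : R := 4 * expR 2^-1.

Lemma spike_bound_ge1 (R : realType) : 1 <= spike_bound R.
Proof.
have := expR_ge1Dx (2^-1 : R).
by rewrite /spike_bound; lra.
Qed.

Lemma spike_le {R : realType} (s : R) : spike s <= spike_bound R.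
Proof.
rewrite /spike_bound (_ : 4 = 2 * 2); last by ring.
rewrite -mulrA [2 * expR _]mulrC /spike ler_pM ?mulr_ge0 ?flat_ge0 ?expR_ge0//.
  exact: (flat_le 2).
by rewrite ler_wpM2l ?expR_ge0//; exact: (flat_le 2).
Qed.

Lemma spike_out {R : realType} (s : R) : 1 <= `|s| -> spike s = 0.
Proof.
rewrite ler_normr => /orP[s1|s1]; rewrite /spike.
  by rewrite (@flat_le0 _ 'X^2 (1 - s)) ?mulr0//; lra.
by rewrite flat_le0 ?mul0r//; apply: step_arg_le0; lra.
Qed.

Lemma spike0_gt0 {R : realType} : 0 < @spike R 0.
Proof.
rewrite /spike subr0 !mulr_gt0 ?expR_gt0 ?flat_gt0//.
rewrite /flat ltr01 hornerXn expr0 mul1r invr1 -expRD subr_gt0 -[ltRHS]expR0 ltr_expR; lra.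
Qed.

(** By scaling, this bounds the mass of every mollifier below by the same
    constant. *)
Lemma spike_near0 {R : realType} : exists2 d : R, 0 < d <= 1 &
  forall s, `|s| <= d -> @spike R 0 / 2 <= spike s.
Proof.
have cb : {for 0, continuous (@spike R)}.
  apply: differentiable_continuous; apply/derivable1_diffP.
  by have [] := @smooth_spike R 1%N.
have /cvgrPdist_le/(_ (spike 0 / 2)) := cb.
rewrite divr_gt0 ?spike0_gt0// => /(_ isT)/nbhs_ballP[e /= e0 He].
exists (Num.min (e / 2) 1).
  by rewrite lt_min ltr01 divr_gt0//= ge_min lexx orbT.
move=> s; rewrite le_min => /andP[se _].
have /He : ball (0:R) e s.
  rewrite /ball/= sub0r normrN (le_lt_trans se)//; lra.
by rewrite ler_norml => /andP[_]; lra.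
Qed.

(** * Products of one-variable functions, and cubes *)

Definition tprod {R : realType} (f : 'I_3 -> R -> R) (x : R3 R) : R :=
  f 0 x.1.1 * f 1 x.1.2 * f 2%R x.2.

Definition box {R : realType} (r : R) : set (R3 R) :=
  ([set` `[- r, r]] `*` [set` `[- r, r]]) `*` [set` `[- r, r]].

Lemma boxP {R : realType} (r : R) (x : R3 R) :
  box r x <-> [/\ `|x.1.1| <= r, `|x.1.2| <= r & `|x.2| <= r].
Proof.
rewrite /box/= !in_itv/= !ler_norml; split; first by case => -[].
by case.
Qed.

Lemma tprod_le {R : realType} (f : 'I_3 -> R -> R) (a b c : R) (x : R3 R) :
  `|f 0 x.1.1| <= a -> `|f 1 x.1.2| <= b -> `|f 2%R x.2| <= c ->
  `|tprod f x| <= a * b * c.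
Proof. by move=> fa fb fc; rewrite !normrM !ler_pM. Qed.

(** Reduces a directional derivative in space to an ordinary one, when the
    increments of f along v are a constant multiple of those of a function of
    one variable. *)
Lemma is_derive_slice {R : realType} (f : R3 R -> R) (v x : R3 R)
    (a : R -> R) (t K a' : R) :
  (forall h : R, f (h *: v + x) - f x = (a (h + t) - a t) * K) ->
  is_derive t (1:R) a a' -> is_derive x v f (a' * K).
Proof.
move=> fa [da <-].
have cv : (fun h : R => h^-1 *: ((f \o shift x) (h *: v) - f x)) @ 0^'
    --> ('D_1 a t * K).
  have -> : (fun h : R => h^-1 *: ((f \o shift x) (h *: v) - f x)) =
      (fun h : R => (h^-1 *: ((a \o shift t) (h *: (1:R)) - a t)) * K).
    by apply/funext => h /=; rewrite fa scalerAl /GRing.scale/= mulr1.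
  by apply: cvgMr_tmp; exact: da.
by apply: DeriveDef; [exact: cvgP cv|apply/cvg_lim].
Qed.

Definition derive_factor {R : realType} (i : 'I_3) (f : 'I_3 -> R -> R) : 'I_3 -> R -> R :=
  fun j => if j == i then (f j)^`()%classic else f j.

Lemma is_derive_tprod {R : realType} (f : 'I_3 -> R -> R) (i : 'I_3) (x : R3 R) :
  (forall j t, derivable (f j) t 1) ->
  is_derive x (basis3 R i) (tprod f) (tprod (derive_factor i f) x).
Proof.
move=> df.
have D j t : is_derive t (1:R) (f j) ((f j)^`()%classic t).
  by rewrite derive1E; exact/derivableP.
case: i => -[|[|[|//]]] lt3; rewrite /tprod /derive_factor /=.
- rewrite -mulrA.
  apply: (@is_derive_slice _ _ _ _ (f 0) x.1.1 (f 1 x.1.2 * f 2%R x.2) _ _ (D 0 _)).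
  by move=> h /=; rewrite /GRing.scale/= !mulr1 !mulr0 !add0r; ring.
- rewrite -mulrA mulrCA.
  apply: (@is_derive_slice _ _ _ _ (f 1) x.1.2 (f 0 x.1.1 * f 2%R x.2) _ _ (D 1 _)).
  by move=> h /=; rewrite /GRing.scale/= !mulr1 !mulr0 !add0r; ring.
- rewrite mulrC.
  apply: (@is_derive_slice _ _ _ _ (f 2%R) x.2 (f 0 x.1.1 * f 1 x.1.2) _ _ (D 2%R _)).
  by move=> h /=; rewrite /GRing.scale/= !mulr1 !mulr0 !add0r; ring.
Qed.

Lemma continuous_tprod {R : realType} (f : 'I_3 -> R -> R) :
  (forall j, continuous (f j)) -> continuous (tprod f).
Proof.
move=> cf x; rewrite /tprod.
apply: (@cvgM _ _ (nbhs x)); first apply: cvgM.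
- apply: (@cvg_comp _ _ _ (fun y : R3 R => y.1.1) (f 0)); last exact: cf.
  by apply: (@cvg_comp _ _ _ fst fst); [exact: cvg_fst|exact: cvg_fst].
- apply: (@cvg_comp _ _ _ (fun y : R3 R => y.1.2) (f 1)); last exact: cf.
  by apply: (@cvg_comp _ _ _ fst snd); [exact: cvg_fst|exact: cvg_snd].
- apply: (@cvg_comp _ _ _ snd (f 2%R)); last exact: cf.
  exact: cvg_snd.
Qed.

(** Each partial derivative of a product of one-variable functions is again such
    a product, so all iterated ones are. *)
Lemma smooth_tprod {R : realType} (f : 'I_3 -> R -> R) :
  (forall j, smooth1 (f j)) -> smooth (tprod f).
Proof.
move=> sf s.
have [g [sg ->]] : exists g, (forall j, smooth1 (g j)) /\ pderivs s (tprod f) = tprod g.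
  elim: s => [|i s [g [sg IH]]]; first by exists f.
  exists (derive_factor i g); split.
    move=> j; rewrite /derive_factor; case: eqP => // _ n.
    by have [] := sg j n.+1.
  rewrite /= IH; apply/funext => x.
  have : is_derive x (basis3 R i) (tprod g) (tprod (derive_factor i g) x).
    by apply: is_derive_tprod => j; have [] := sg j 1%N.
  by case.
have dg j t : derivable (g j) t 1 by have [] := sg j 1%N.
split=> [|x i]; last by have [] := is_derive_tprod g i x dg.
apply: continuous_tprod => j t.
by apply: differentiable_continuous; apply/derivable1_diffP.
Qed.

Lemma measurable_tprod {R : realType} (f : 'I_3 -> R -> R) :
  (forall j, smooth1 (f j)) -> measurable_fun [set: R3 R] (tprod f).
Proof.
move=> sf.
have mf j : measurable_fun [set: R] (f j).
  apply: continuous_measurable_fun => t.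
  apply: differentiable_continuous; apply/derivable1_diffP.
  by have [] := sf j 1%N.
have m1 : measurable_fun [set: R3 R]
    (fst : R3 R -> measurableTypeR R * measurableTypeR R) by exact: measurable_fst.
apply: measurable_funM; first apply: measurable_funM.
- by apply: measurableT_comp (mf _) _; exact: measurableT_comp measurable_fst m1.
- by apply: measurableT_comp (mf _) _; exact: measurableT_comp measurable_snd m1.
- by apply: measurableT_comp (mf _) _; exact: measurable_snd.
Qed.

Lemma compact_box {R : realType} (r : R) : compact (box r).
Proof.
by apply: compact_setX; [apply: compact_setX|]; exact: segment_compact.
Qed.

Lemma closed_box {R : realType} (r : R) : closed (box r).
Proof. apply: compact_closed; [exact: norm_hausdorff|exact: compact_box]. Qed.

Lemma measurable_box {R : realType} (r : R) : measurable (box r).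
Proof. by apply: measurableX; [apply: measurableX|]; exact: measurable_itv. Qed.

Lemma leb3_box {R : realType} (r : R) : 0 <= r -> leb3 R (box r) = (8 * r ^+ 3)%:E.
Proof.
move=> r0.
have mI := @measurable_itv R `[- r, r].
have mu : @lebesgue_measure R [set` `[- r, r]] = (2 * r)%:E.
  rewrite lebesgue_measure_itv/= lte_fin.
  case: ltP => rr; first by rewrite -EFinB; congr EFin; ring.
  by rewrite (_ : r = 0) ?mulr0//; lra.
have e2 := @product_measure1E _ _ _ _ R (@lebesgue_measure R)
  (@lebesgue_measure R) _ _ mI mI.
have e3 := @product_measure1E _ _ _ _ R (@lebesgue_measure R \x @lebesgue_measure R)%E
  (@lebesgue_measure R) _ _ (measurableX mI mI) mI.
apply: (etrans e3).
transitivity ((2 * r)%:E * (2 * r)%:E * (2 * r)%:E)%E.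
  by congr (_ * _)%E; [apply: (etrans e2); congr (_ * _)%E|]; exact: mu.
by rewrite -!EFinM; congr EFin; ring.
Qed.

Lemma tprod_out {R : realType} (f : 'I_3 -> R -> R) (r : R) :
  (forall j t, r <= `|t| -> f j t = 0) ->
  forall x, ~ box r x -> tprod f x = 0.
Proof.
move=> fr x nb; rewrite /tprod.
have [h1|h1] := leP `|x.1.1| r; last by rewrite fr ?mul0r// ltW.
have [h2|h2] := leP `|x.1.2| r; last by rewrite (fr 1) ?mulr0 ?mul0r// ltW.
have [h3|h3] := leP `|x.2| r; last by rewrite (fr 2%R) ?mulr0// ltW.
by case: nb; apply/boxP.
Qed.

Lemma test_function_tprod {R : realType} (f : 'I_3 -> R -> R) (r : R) :
  (forall j, smooth1 (f j)) -> (forall j t, r <= `|t| -> f j t = 0) ->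
  test_function (tprod f).
Proof.
move=> sf fr; split; first exact: smooth_tprod.
apply: (subclosed_compact _ (@compact_box _ r)); first exact: closed_closure.
rewrite (closure_id (box r)).1; last exact: closed_box.
apply: closureS => x /= fx0; apply: contrapT => /(tprod_out _ _ fr) f0.
by rewrite f0 eqxx in fx0.
Qed.

(** * Comparison of m with Lebesgue measure near the origin *)

(** With this constant, psi_lb / r bounds psi from below on the punctured cube of
    half-side r <= 1, where the Euclidean norm is at most 2 r <= 2. *)
Definition psi_lb {R : realType} (gamma : R) : R :=
  Num.sqrt gamma / Num.sqrt (2 * pi) * (expR (- gamma * 2) / 2).

Lemma psi_lb_gt0 {R : realType} (gamma : R) : 0 < gamma -> 0 < psi_lb gamma.
Proof.
move=> g0; rewrite /psi_lb !mulr_gt0 ?invr_gt0 ?sqrtr_gt0 ?expR_gt0//.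
by rewrite mulr_gt0 ?pi_gt0.
Qed.

(** The factor 2 is an upper bound for the square root of 3. *)
Lemma enorm_le_box {R : realType} (r : R) (x : R3 R) : box r x -> enorm x <= 2 * r.
Proof.
move=> /boxP[h1 h2 h3].
have r0 : 0 <= r by rewrite (le_trans _ h1).
have sq (t : R) : `|t| <= r -> t ^+ 2 <= r ^+ 2.
  by move=> tr; rewrite -real_normK ?num_real// ler_pXn2r ?nnegrE.
rewrite /enorm -[leRHS]ger0_norm ?mulr_ge0// -sqrtr_sqr ler_sqrt ?sqr_ge0//.
by rewrite exprMn; move: (sq _ h1) (sq _ h2) (sq _ h3) (sqr_ge0 r); lra.
Qed.

Lemma enorm_gt0 {R : realType} (x : R3 R) : ~ box 0 x -> 0 < enorm x.
Proof.
move=> nb; rewrite lt0r enorm_ge0 andbT; apply/negP => /eqP n0; apply: nb.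
have : enorm x ^+ 2 = 0 by rewrite n0 expr0n.
rewrite sqr_sqrtr ?addr_ge0 ?sqr_ge0// => s0.
have sq (t : R) : t ^+ 2 <= 0 -> `|t| <= 0.
  by move=> t0; rewrite normr_le0 -sqrf_eq0 eq_le t0 sqr_ge0.
by apply/boxP; split; apply: sq; move: s0 (sqr_ge0 x.1.1) (sqr_ge0 x.1.2)
  (sqr_ge0 x.2); lra.
Qed.

Lemma psi_ge_box {R : realType} (gamma r : R) (x : R3 R) :
  0 < gamma -> 0 < r <= 1 -> box r x -> ~ box 0 x ->
  psi_lb gamma / r <= psi gamma x.
Proof.
move=> g0 /andP[r0 r1] /enorm_le_box nr /enorm_gt0 n0.
rewrite /psi_lb /psi -!mulrA ler_wpM2l ?sqrtr_ge0// ler_wpM2l ?invr_ge0 ?sqrtr_ge0//.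
rewrite ler_pM ?expR_ge0//.
- by rewrite mulr_ge0// ?invr_ge0 ltW.
- rewrite ler_expR ler_nM2l ?oppr_lt0//; lra.
- by rewrite -invfM lef_pV2 ?posrE// mulr_gt0.
Qed.

(** This is where the singularity of the density enters: m dominates Lebesgue
    measure with a constant that grows like 1/r^2. The origin, where psi takes
    the value 0, is the null set box 0. *)
Lemma leb3_le_m3 {R : realType} (gamma r : R) (A : set (R3 R)) :
  0 < gamma -> 0 < r <= 1 -> measurable A -> A `<=` box r ->
  (((psi_lb gamma / r) ^+ 2)%:E * leb3 R A <= m3 gamma A)%E.
Proof.
move=> g0 r01 mA Ar.
have b0 : leb3 R (box 0) = 0%E by rewrite leb3_box// expr0n mulr0.
have c0 : 0 <= psi_lb gamma / r.
  by rewrite divr_ge0 ?ltW ?psi_lb_gt0//; case/andP: r01.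
have mpsi B : measurable_fun B (EFin \o (fun x : R3 R => (psi gamma x) ^+ 2)).
  apply/measurable_funTS/measurable_EFinP.
  by apply: measurable_funX; exact: measurable_psi.
rewrite /m3 -integral_cst//.
rewrite (@ge0_negligible_integral _ _ _ (leb3 R) A (box 0))//; last 2 first.
- exact: measurable_box.
- by move=> x _; rewrite lee_fin sqr_ge0.
rewrite [leRHS](@ge0_negligible_integral _ _ _ (leb3 R) A (box 0))//; last 2 first.
- exact: measurable_box.
- by move=> x _; rewrite lee_fin sqr_ge0.
apply: ge0_le_integral => //.
- by apply: measurableD => //; exact: measurable_box.
- by move=> x _; rewrite lee_fin sqr_ge0.
move=> x [Ax nb]; have h := psi_ge_box _ _ _ g0 r01 (Ar _ Ax) nb.
by rewrite lee_fin ler_pXn2r ?nnegrE// (le_trans _ h).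
Qed.

Section dominated.
Import HBNNSimple.

(** A simple function below f restricted to D takes its nonzero values on subsets
    of D, so it is enough to compare the measures there. *)
Lemma ge0_le_integral_dominated {d} {T : measurableType d} {R : realType}
    (mu nu : {measure set T -> \bar R}) (D : set T) (f : T -> \bar R) :
  measurable D -> (forall A, measurable A -> A `<=` D -> (mu A <= nu A)%E) ->
  (forall x, 0 <= f x)%E ->
  (\int[mu]_(x in D) f x <= \int[nu]_(x in D) f x)%E.
Proof.
move=> mD munu f0.
rewrite !ge0_integralE//= ge_ereal_sup// => _ [h/= hfD] <-.
apply: le_ereal_sup_tmp; exists (sintegral nu h); first by exists h.
rewrite !sintegralE lee_fsum// => r [t _ <-].
have [->|ht0] := eqVneq (h t) 0; first by rewrite !mul0e.
rewrite lee_pmul ?lee_fin//; apply: munu => // y /= hy.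
apply: contrapT => nD; move/negP: ht0; apply.
have := hfD y; rewrite patchE memNset// hy lee_fin => ht.
by rewrite eq_le ht/=.
Qed.

End dominated.

(** * Pairings with functions of size 1/r^2 on a cube of side 2r *)

Lemma integral_sqr_box {R : realType} (gamma r : R) (w : R3 R -> R) :
  0 < gamma -> 0 < r <= 1 -> w \in Lfun (m3 gamma) 2%:E ->
  (((psi_lb gamma / r) ^+ 2)%:E * \int[leb3 R]_(x in box r) ((w x ^+ 2)%:E)
   <= (\int[m3 gamma]_x (w x * w x))%:E)%E.
Proof.
move=> g0 r01 w2.
have iw := Lfun2_integrable_sqr w2.
have mw := measurable_int _ iw.
have -> : (\int[m3 gamma]_x (w x * w x))%:E = (\int[m3 gamma]_x ((w x ^+ 2)%:E))%E.
  by rewrite /Rintegral fineK//; exact: (integrable_fin_num measurableT iw).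
have c0 : 0 <= (psi_lb gamma / r) ^+ 2 by exact: sqr_ge0.
have mb := @measurable_box R r.
rewrite -(@ge0_integral_mscale _ _ _ (leb3 R) _ mb (NngNum c0))//; last 2 first.
- exact: measurable_funTS.
- by move=> x _; rewrite lee_fin sqr_ge0.
apply: (@le_trans _ _ (\int[m3 gamma]_(x in box r) ((w x ^+ 2)%:E))%E); last first.
  by apply: ge0_subset_integral => // x _; rewrite lee_fin sqr_ge0.
apply: ge0_le_integral_dominated => //.
  by move=> A mA Ar; exact: leb3_le_m3.
by move=> x; rewrite lee_fin sqr_ge0.
Qed.

(** Completing the square: the difference of the two sides is
    ((lam s - 1/2)^2 + 3/4) / lam for s = |t|. *)
Lemma young_abs {R : realType} (lam t : R) : 0 < lam -> `|t| <= lam * t ^+ 2 + lam^-1.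
Proof.
move=> l0; rewrite -(real_normK (num_real t)); set s := `|t|.
have -> : lam * s ^+ 2 + lam^-1 = s + lam^-1 * ((lam * s - 2^-1) ^+ 2 + 3 / 4).
  by field; rewrite gt_eqF.
by rewrite lerDl mulr_ge0// ?invr_ge0 ?ltW// ltr_wpDl ?sqr_ge0.
Qed.

(** On the cube, |w phi| <= L/r^2 (lam w^2 + 1/lam). The first term is integrated
    with integral_sqr_box, which costs a factor r^2 that cancels the size of
    phi; the second gives L/r^2 times the volume 8 r^3 over lam, and tends to 0
    with r. *)
Lemma L2_pairing {R : realType} (gamma r L lam : R) (w phi : R3 R -> R) :
  0 < gamma -> 0 < r <= 1 -> 0 <= L -> 0 < lam ->
  w \in Lfun (m3 gamma) 2%:E -> measurable_fun [set: R3 R] phi ->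
  (forall x, `|phi x| <= L / r ^+ 2) -> (forall x, ~ box r x -> phi x = 0) ->
  (leb3 R).-integrable [set: R3 R] (EFin \o (fun x => w x * phi x)) /\
  `|\int[leb3 R]_x (w x * phi x)| <=
    L * (lam / psi_lb gamma ^+ 2 * \int[m3 gamma]_x (w x * w x) + 8 * r / lam).
Proof.
move=> g0 r01 L0 l0 w2 mphi phiL phi0.
have /andP[r0 r1] := r01.
have c0 := psi_lb_gt0 _ g0.
have mw : measurable_fun [set: R3 R] w.
  by move: w2; rewrite inE => /andP[]; rewrite inE.
have mb := @measurable_box R r.
have mw2 : measurable_fun [set: R3 R] (EFin \o (fun x => w x ^+ 2)).
  by apply/measurable_EFinP; exact: measurable_funX.
have mwphi : measurable_fun [set: R3 R] (EFin \o (fun x => w x * phi x)).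
  by apply/measurable_EFinP; exact: measurable_funM.
set W := \int[m3 gamma]_x (w x * w x).
have box_le : (\int[leb3 R]_(x in box r) ((w x ^+ 2)%:E)
    <= ((psi_lb gamma / r) ^- 2 * W)%:E)%E.
  rewrite EFinM lee_pdivlMl ?exprn_gt0 ?divr_gt0//.
  exact: integral_sqr_box.
have int_le : (\int[leb3 R]_x `|(w x * phi x)%:E| <=
    (L * (lam / psi_lb gamma ^+ 2 * W + 8 * r / lam))%:E)%E.
  have l0' := ltW l0.
  have li0 : 0 <= lam^-1 by rewrite invr_ge0.
  pose h (x : R3 R) := ((L / r ^+ 2)%:E * (lam%:E * (w x ^+ 2)%:E + (lam^-1)%:E))%E.
  have L2 : 0 <= L / r ^+ 2 by rewrite divr_ge0// sqr_ge0.
  have h0 x : (0 <= h x)%E.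
    rewrite /h -!EFinM lee_fin mulr_ge0// addr_ge0//.
    by rewrite mulr_ge0// sqr_ge0.
  have mh : measurable_fun (box r) h.
    apply: measurable_funTS; apply: emeasurable_funM => //.
    by apply: emeasurable_funD => //; exact: emeasurable_funM.
  apply: (@le_trans _ _ (\int[leb3 R]_(x in box r) h x)%E).
    rewrite [leRHS]integral_mkcond; apply: ge0_le_integral => //.
    - exact: measurableT_comp.
    - by apply/(measurable_restrictT _ _).1.
    move=> x _; rewrite patchE; case: ifPn => [_|].
      rewrite /h abse_EFin -!EFinM lee_fin normrM mulrC.
      by rewrite ler_pM// young_abs.
    by rewrite notin_setE => /phi0 ->; rewrite mulr0 abse0.
  rewrite ge0_integralZl//; last 2 first.
  - apply: emeasurable_funD => //; apply: emeasurable_funM => //.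
    exact: measurable_funTS.
  - by move=> x _; rewrite -EFinM -EFinD lee_fin addr_ge0// mulr_ge0// sqr_ge0.
  rewrite ge0_integralD//; last 2 first.
  - by move=> x _; rewrite -EFinM lee_fin mulr_ge0// sqr_ge0.
  - by apply: emeasurable_funM => //; exact: measurable_funTS.
  rewrite ge0_integralZl//; last 2 first.
  - exact: measurable_funTS.
  - by move=> x _; rewrite lee_fin sqr_ge0.
  have -> : (\int[leb3 R]_(x in box r) lam^-1%:E = lam^-1%:E * (8 * r ^+ 3)%:E)%E.
    by rewrite integral_cst//; congr (_ * _)%E; exact: leb3_box (ltW r0).
  apply: (@le_trans _ _ ((L / r ^+ 2)%:E *
      (lam%:E * ((psi_lb gamma / r) ^- 2 * W)%:E + lam^-1%:E * (8 * r ^+ 3)%:E))%E).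
    by rewrite lee_wpmul2l ?lee_fin// leeD2r// lee_wpmul2l ?lee_fin.
  rewrite -!EFinM lee_fin.
  rewrite le_eqVlt; apply/orP; left; apply/eqP.
  by field; rewrite !gt_eqF.
have iwphi : (leb3 R).-integrable [set: R3 R] (EFin \o (fun x => w x * phi x)).
  by apply/integrableP; split=> //; exact: le_lt_trans int_le (ltry _).
split=> //; rewrite -lee_fin EFin_normr_Rintegral//.
by apply: le_trans int_le; exact: le_abse_integral.
Qed.

(** * Mollifiers at the scales 4^-k and the fluxes between them *)

Lemma inv4X_gt0_le1 {R : realType} k : 0 < (4 ^- k : R) <= 1.
Proof. by rewrite invr_gt0 exprn_gt0//= invf_le1 ?exprn_gt0// exprn_ege1//; lra. Qed.

Definition scaled_spike {R : realType} (k : nat) (s : R) : R := 4 ^+ k * spike (4 ^+ k * s).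

(** The compactly supported primitive of scaled_spike k - scaled_spike k.+1. *)
Definition step_gap {R : realType} (k : nat) (s : R) : R :=
  step (4 ^+ k * s) - step (4 ^+ k.+1 * s).

Lemma is_derive_scale {R : realType} (f : R -> R) (c t d : R) :
  is_derive (c * t) (1:R) f d -> is_derive t (1:R) (fun s : R => f (c * s)) (c * d).
Proof.
move=> fd.
have dc : is_derive t (1:R) (fun s : R => c * s) c.
  by have := is_deriveZ c (is_derive_id t (1:R)); rewrite /GRing.scale/= mulr1.
rewrite mulrC; exact: (@is_derive1_comp R f (fun s : R => c * s) _ _ _ fd dc).
Qed.

Lemma is_derive_step_gap {R : realType} k (s : R) :
  is_derive s (1:R) (step_gap k) (scaled_spike k s - scaled_spike k.+1 s).
Proof.
exact: is_deriveB (is_derive_scale _ _ _ _ (is_derive_step _))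
                  (is_derive_scale _ _ _ _ (is_derive_step _)).
Qed.

Lemma smooth_scaled_spike {R : realType} k : smooth1 (@scaled_spike R k).
Proof.
move=> n; apply: smooth_uptoM; first exact: smooth_upto_cst.
apply: smooth_upto_comp; first exact: smooth_spike.
by apply: smooth_uptoM; [exact: smooth_upto_cst|exact: smooth_upto_id].
Qed.

Lemma smooth_step_gap {R : realType} k : smooth1 (@step_gap R k).
Proof.
case=> // n; apply: smooth_uptoS (is_derive_step_gap k) _.
have -> : (fun s : R => scaled_spike k s - scaled_spike k.+1 s) =
    (fun s => scaled_spike k s + (-1) * scaled_spike k.+1 s).
  by apply/funext => s; rewrite mulN1r.
apply: smooth_uptoD; first exact: smooth_scaled_spike.
by apply: smooth_uptoM; [exact: smooth_upto_cst|exact: smooth_scaled_spike].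
Qed.

Lemma scaled_spike_ge0 {R : realType} k (s : R) : 0 <= scaled_spike k s.
Proof. by rewrite mulr_ge0 ?exprn_ge0 ?spike_ge0. Qed.

Lemma scaled_spike_le {R : realType} k (s : R) : scaled_spike k s <= 4 ^+ k * spike_bound R.
Proof. by rewrite ler_wpM2l ?exprn_ge0// spike_le. Qed.

Lemma scale_ge1 {R : realType} k (s : R) :
  4 ^- k <= `|s| -> 1 <= `|4 ^+ k * s|.
Proof.
move=> ks; rewrite normrM ger0_norm ?exprn_ge0// -ler_pdivrMl ?exprn_gt0//.
by rewrite mulr1.
Qed.

Lemma scaled_spike_out {R : realType} k (s : R) : 4 ^- k <= `|s| -> scaled_spike k s = 0.
Proof. by move=> /scale_ge1 ks; rewrite /scaled_spike spike_out ?mulr0. Qed.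

Lemma step_gap_out {R : realType} k (s : R) : 4 ^- k <= `|s| -> step_gap k s = 0.
Proof.
move=> ks; have k1 := scale_ge1 _ _ ks.
have k2 : 1 <= `|4 ^+ k.+1 * s|.
  by rewrite exprS -mulrA normrM ger0_norm//; lra.
(* To the right both steps equal the same constant, to the left both vanish. *)
rewrite /step_gap; have [s0|s0] := leP 0 s.
  rewrite !ger0_norm ?mulr_ge0 ?exprn_ge0// in k1 k2.
  by rewrite step_right// (step_right (_ ^+ k.+1 * _))// subrr.
have neg n : 4 ^+ n * s <= 0 by rewrite mulr_ge0_le0 ?exprn_ge0// ltW.
rewrite !ler0_norm// in k1 k2.
by rewrite !step_left ?subrr//; lra.
Qed.

Lemma step_gap_norm_le1 {R : realType} k (s : R) : `|step_gap k s| <= 1.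
Proof.
rewrite /step_gap ler_norml.
move: (step_ge0 (4 ^+ k * s)) (step_ge0 (4 ^+ k.+1 * s)).
move: (step_le1 (4 ^+ k * s)) (step_le1 (4 ^+ k.+1 * s)); lra.
Qed.

(** Interpolates between two scales one coordinate at a time, so that each step
    is a derivative in a single direction. *)
Definition mollifier {R : realType} (k i : nat) : R3 R -> R :=
  tprod (fun j : 'I_3 => scaled_spike (if (j < i)%N then k.+1 else k)).

Definition flux_factor {R : realType} (k i : nat) (j : 'I_3) : R -> R :=
  if j == i :> nat then step_gap k else scaled_spike (if (j < i)%N then k.+1 else k).

Definition flux {R : realType} (k i : nat) : R3 R -> R := tprod (flux_factor k i).

(** Passing from i to i.+1 changes a single factor, from scaled_spike k to
    scaled_spike k.+1, and the difference of these two is the derivative of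
    step_gap k. The fluxes for i = 0, 1, 2 are thus the components of a field
    whose divergence is the difference of two consecutive mollifiers. *)
Lemma derive_flux {R : realType} k (i : 'I_3) (x : R3 R) :
  'D_(basis3 R i) (flux k i) x = mollifier k i x - mollifier k i.+1 x.
Proof.
have df (j : 'I_3) (t : R) : derivable (@flux_factor R k i j) t 1.
  rewrite /flux_factor; case: ifP => _; first by have [] := @smooth_step_gap R k 1%N.
  by set n := (if _ then _ else _); have [] := @smooth_scaled_spike R n 1%N.
have [_ ->] := is_derive_tprod _ i x df.
have ds t : (@step_gap R k)^`()%classic t = scaled_spike k t - scaled_spike k.+1 t.
  by rewrite derive1E; have [] := is_derive_step_gap k t.
rewrite /mollifier /tprod /derive_factor /flux_factor.
by case: i {df} => -[|[|[|//]]] lt3 /=; rewrite ds; ring.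
Qed.

Lemma mollifier3 {R : realType} k : @mollifier R k 3 = mollifier k.+1 0.
Proof. by []. Qed.

Lemma scaled_spike_out_le {R : realType} k (b : bool) (s : R) :
  4 ^- k <= `|s| -> scaled_spike (if b then k.+1 else k) s = 0.
Proof.
move=> ks; apply: scaled_spike_out; apply: le_trans ks; case: b => //.
by rewrite lef_pV2 ?posrE ?exprn_gt0// ler_eXn2l//; lra.
Qed.

Lemma mollifier_out {R : realType} k i (x : R3 R) :
  ~ box (4 ^- k) x -> mollifier k i x = 0.
Proof. by apply: tprod_out => j t; exact: scaled_spike_out_le. Qed.

Lemma flux_factor_out {R : realType} k i j (t : R) :
  4 ^- k <= `|t| -> flux_factor k i j t = 0.
Proof.
move=> kt; rewrite /flux_factor; case: ifP => _; first exact: step_gap_out.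
exact: scaled_spike_out_le.
Qed.

Lemma smooth_flux_factor {R : realType} k i j : smooth1 (@flux_factor R k i j).
Proof.
rewrite /flux_factor; case: ifP => _; first exact: smooth_step_gap.
exact: smooth_scaled_spike.
Qed.

Lemma test_function_flux {R : realType} k i : test_function (@flux R k i).
Proof.
apply: (@test_function_tprod _ _ (4 ^- k)); first exact: smooth_flux_factor.
by move=> j t; exact: flux_factor_out.
Qed.

Lemma mollifier_le {R : realType} k i (x : R3 R) :
  `|mollifier k i x| <= (4 ^+ k.+1 * spike_bound R) ^+ 3.
Proof.
have b (j : 'I_3) (t : R) :
    `|scaled_spike (if (j < i)%N then k.+1 else k) t| <= 4 ^+ k.+1 * spike_bound R.
  rewrite ger0_norm ?scaled_spike_ge0//; case: ifP => _; first exact: scaled_spike_le.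
  apply: (le_trans (scaled_spike_le _ _)); rewrite ler_wpM2r ?ler_eXn2l//.
    by rewrite (le_trans _ (spike_bound_ge1 R)).
  lra.
set A := 4 ^+ k.+1 * spike_bound R in b *.
rewrite (_ : A ^+ 3 = A * A * A); last by ring.
by apply: tprod_le; exact: b.
Qed.

(** The factor step_gap is bounded by 1 and each of the other two by 4^k or
    4^(k+1) times the bound on spike. The exponent 3 lets the same
    constant 16 * spike_bound R ^+ 3 bound the mollifier at scale 1 as well. *)
Lemma flux_le {R : realType} k (i : 'I_3) (x : R3 R) :
  `|flux k i x| <= 16 * spike_bound R ^+ 3 / (4 ^- k) ^+ 2.
Proof.
have M1 := spike_bound_ge1 R.
have q0 : (0:R) <= 4 ^+ k by rewrite exprn_ge0.
have b n (t : R) : `|scaled_spike n t| <= 4 ^+ n * spike_bound R.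
  by rewrite ger0_norm ?scaled_spike_ge0 ?scaled_spike_le.
have M23 : spike_bound R ^+ 2 <= spike_bound R ^+ 3 by rewrite [leRHS]exprS ler_peMl ?sqr_ge0.
rewrite exprVn invrK.
have H (c : R) : 0 <= c <= 16 ->
    c * (4 ^+ k) ^+ 2 * spike_bound R ^+ 2 <= 16 * spike_bound R ^+ 3 * (4 ^+ k) ^+ 2.
  move=> /andP[c0 c16]; rewrite mulrAC ler_wpM2r ?sqr_ge0//.
  by rewrite ler_pM ?sqr_ge0.
rewrite /flux.
case: i => -[|[|[|//]]] lt3 /=.
- apply: (@le_trans _ _ (1 * (4 ^+ k * spike_bound R) * (4 ^+ k * spike_bound R))).
    by apply: tprod_le; rewrite /flux_factor/= ?step_gap_norm_le1.
  apply: le_trans (H 1 _); last by lra.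
  by rewrite ?exprS le_eqVlt; apply/orP; left; apply/eqP; move: (4 ^+ k) => q; ring.
- apply: (@le_trans _ _ ((4 ^+ k.+1 * spike_bound R) * 1 * (4 ^+ k * spike_bound R))).
    by apply: tprod_le; rewrite /flux_factor/= ?step_gap_norm_le1.
  apply: le_trans (H 4 _); last by lra.
  by rewrite ?exprS le_eqVlt; apply/orP; left; apply/eqP; move: (4 ^+ k) => q; ring.
- apply: (@le_trans _ _ ((4 ^+ k.+1 * spike_bound R) * (4 ^+ k.+1 * spike_bound R) * 1)).
    by apply: tprod_le; rewrite /flux_factor/= ?step_gap_norm_le1.
  apply: le_trans (H 16 _); last by lra.
  by rewrite ?exprS le_eqVlt; apply/orP; left; apply/eqP; move: (4 ^+ k) => q; ring.
Qed.

(** * Mollified values are controlled by the energy *)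

Section estimate.
Context {R : realType} (gamma : R) (gamma_gt0 : 0 < gamma).

Local Notation L2m := (Lfun (m3 gamma) 2%:E).
Local Notation sqint w := (\int[m3 gamma]_x (w x * w x)).
Let L : R := 16 * spike_bound R ^+ 3.
Let c : R := psi_lb gamma.

Let L_ge0 : 0 <= L.
Proof. by rewrite mulr_ge0// exprn_ge0// (le_trans _ (spike_bound_ge1 R)). Qed.

Lemma integrable_mollifier (w : R3 R -> R) k i : w \in L2m ->
  (leb3 R).-integrable [set: R3 R] (EFin \o (fun x => w x * mollifier k i x)).
Proof.
move=> w2.
pose A : R := (4 ^+ k.+1 * spike_bound R) ^+ 3.
have A0 : 0 <= A.
  by rewrite exprn_ge0// mulr_ge0 ?exprn_ge0// (le_trans _ (spike_bound_ge1 R)).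
have [k0 k1] := andP (@inv4X_gt0_le1 R k).
have [] := @L2_pairing R gamma (4 ^- k) A 1 w (mollifier k i) gamma_gt0 (inv4X_gt0_le1 k)
  A0 ltr01 w2 _ _ (mollifier_out k i) => //.
  by apply: measurable_tprod => j; exact: smooth_scaled_spike.
move=> x; apply: le_trans (mollifier_le k i x) _.
by rewrite ler_peMr// invf_ge1 ?exprn_gt0// exprn_ile1// ltW.
Qed.

(** L2_pairing with r = 4^-k and lam = Lam 2^-k: both terms then decay like
    2^-k. *)
Lemma flux_pairing (w : R3 R -> R) k (i : 'I_3) (Lam : R) : 0 < Lam -> w \in L2m ->
  `|\int[leb3 R]_x (w x * flux k i x)| <=
    2 ^- k * (L * (Lam / c ^+ 2 * sqint w + 8 / Lam)).
Proof.
move=> Lam0 w2.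
have [] := @L2_pairing R gamma (4 ^- k) L (Lam * 2 ^- k) w (flux k i) gamma_gt0
  (inv4X_gt0_le1 k) L_ge0 _ w2 _ (flux_le k i) _.
- by rewrite mulr_gt0// invr_gt0 exprn_gt0.
- by apply: measurable_tprod => j; exact: smooth_flux_factor.
- by apply: tprod_out => j t; exact: flux_factor_out.
move=> _ /le_trans; apply; rewrite le_eqVlt; apply/orP; left; apply/eqP.
have -> : (4 : R) ^+ k = 2 ^+ k * 2 ^+ k by rewrite -exprMn; congr (_ ^+ _); ring.
have c0 : c != 0 by rewrite gt_eqF ?psi_lb_gt0.
have q0 : (2 : R) ^+ k != 0 by rewrite gt_eqF ?exprn_gt0.
rewrite -/c; move: (2 ^+ k) q0 (sqint w) => q q0 W.
by field; rewrite q0 c0 gt_eqF.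
Qed.

(** The definition of the weak gradient, tested against a flux. *)
Lemma integral_mollifier_diff (u : R3 R -> R) (g : 'I_3 -> R3 R -> R) k (i : 'I_3) :
  u \in L2m -> is_weak_gradient u g ->
  \int[leb3 R]_x (u x * mollifier k i x) - \int[leb3 R]_x (u x * mollifier k i.+1 x) =
  - \int[leb3 R]_x (g i x * flux k i x).
Proof.
move=> u2 [_ _ wg]; rewrite -wg; last exact: test_function_flux.
rewrite -RintegralB//; [|exact: integrable_mollifier..].
by apply: eq_Rintegral => x _; rewrite derive_flux mulrBr.
Qed.

(** Sum the geometric series of flux_pairing over the scales below N, starting
    from the integral of u against the mollifier at scale 1. The constant 56 is
    8 + 2 * 24: one term 8 from scale 1, and three terms 8 from the components
    of the field, doubled by the sum of the powers of 1/2. *)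
Lemma mollified_value_bound (u : R3 R -> R) (g : 'I_3 -> R3 R -> R) (Lam : R) (N : nat) :
  0 < Lam -> u \in L2m -> (forall i, g i \in L2m) -> is_weak_gradient u g ->
  `|\int[leb3 R]_x (u x * mollifier N 0 x)| <=
    L * (Lam / c ^+ 2 * (sqint u + 2 * \sum_(i < 3) sqint (g i)) + 56 / Lam).
Proof.
move=> Lam0 u2 g2 ug.
pose I k i := \int[leb3 R]_x (u x * mollifier k i x).
pose S := \sum_(i < 3) (L * (Lam / c ^+ 2 * sqint (g i) + 8 / Lam)).
have sqint0 w : 0 <= sqint w.
  by apply: Rintegral_ge0 => x _; rewrite -expr2 sqr_ge0.
have S0 : 0 <= S.
  apply: sumr_ge0 => i _; rewrite mulr_ge0// addr_ge0 ?mulr_ge0 ?invr_ge0 ?sqr_ge0//.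
    exact: ltW.
  exact: ltW.
have step k : `|I k 0%N - I k.+1 0%N| <= 2 ^- k * S.
  have -> : I k 0%N - I k.+1 0%N =
      \sum_(i < 3) - \int[leb3 R]_x (g i x * flux k i x).
    under eq_bigr => i _ do rewrite -(integral_mollifier_diff u g k i u2 ug).
    by rewrite !big_ord_recl big_ord0/= /I -mollifier3 /bump/= addr0 !addrA !subrK.
  apply: (le_trans (ler_norm_sum _ _ _)); rewrite mulr_sumr.
  by apply: ler_sum => i _; rewrite normrN; exact: flux_pairing.
have tele : `|I 0%N 0%N - I N 0%N| <= (2 - 2 * 2 ^- N) * S.
  elim: N => [|N IH]; first by rewrite subrr normr0 expr0 invr1 mulr1 subrr mul0r.
  rewrite -(subrKA (I N 0%N)) (le_trans (ler_normD _ _))//.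
  apply: (le_trans (lerD IH (step N))).
  rewrite -mulrDl ler_wpM2r// exprS invfM; move: (2 ^- N) => q; lra.
have I0 : `|I 0%N 0%N| <= L * (Lam / c ^+ 2 * sqint u + 8 / Lam).
  have [] := @L2_pairing R gamma 1 L Lam u (mollifier 0 0) gamma_gt0 _ L_ge0 Lam0 u2 _ _ _.
  - by rewrite ltr01 lexx.
  - by apply: measurable_tprod => j; exact: smooth_scaled_spike.
  - move=> x; rewrite expr1n divr1.
    apply: (@le_trans _ _ (spike_bound R * spike_bound R * spike_bound R)).
      apply: tprod_le; rewrite /= ger0_norm ?scaled_spike_ge0//;
        by apply: (le_trans (scaled_spike_le _ _)); rewrite expr0 mul1r.
    have M0 : 0 <= spike_bound R ^+ 3.
      by rewrite exprn_ge0// (le_trans _ (spike_bound_ge1 R)).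
    by rewrite (_ : _ * _ * _ = spike_bound R ^+ 3) ?/L; [lra|ring].
  - by move=> x nb; apply: mollifier_out; rewrite expr0 invr1.
  by rewrite mulr1.
have : `|I N 0%N| <= `|I 0%N 0%N| + `|I 0%N 0%N - I N 0%N|.
  rewrite distrC; apply: le_trans (ler_normD _ _); rewrite addrC subrK//.
move=> /le_trans; apply.
apply: (le_trans (lerD I0 tele)).
apply: (@le_trans _ _ (L * (Lam / c ^+ 2 * sqint u + 8 / Lam) + 2 * S)).
  by rewrite lerD2l ler_wpM2r// gerBl mulr_ge0// invr_ge0 exprn_ge0.
rewrite /S -mulr_sumr big_split/= -mulr_sumr sumr_const card_ord -mulr_natr.
move: (sqint u) (\sum_(i < 3) sqint (g i)) (Lam / c ^+ 2) Lam^-1 => E D A B.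
by rewrite le_eqVlt; apply/orP; left; apply/eqP; ring.
Qed.

End estimate.

(** * Lower bound for the energy and positivity of the capacity *)

(** By domination, an m-null set has Lebesgue-null trace on each small cube. *)
Lemma ae_leb3_of_ae_m3 {R : realType} (gamma r : R) (P : R3 R -> Prop) :
  0 < gamma -> 0 < r <= 1 -> {ae m3 gamma, forall x, P x} ->
  {ae leb3 R, forall x, box r x -> P x}.
Proof.
move=> g0 r01 [A [mA mA0 PA]].
have mAr : measurable (A `&` box r) by apply: measurableI => //; exact: measurable_box.
exists (A `&` box r); split => //.
- have c0 : 0 < (psi_lb gamma / r) ^+ 2.
    by rewrite exprn_gt0// divr_gt0 ?psi_lb_gt0//; case/andP: r01.
  have := leb3_le_m3 _ _ _ g0 r01 mAr (@subIsetr _ _ _).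
  have -> : m3 gamma (A `&` box r) = 0%E.
    by apply: (subset_measure0 mAr mA _ mA0); exact: subIsetl.
  rewrite -[X in (_ <= X)%E](mule0 ((psi_lb gamma / r) ^+ 2)%:E) lee_pmul2l//.
  by rewrite measure_le0 => /eqP.
- move=> x /= /not_implyP[bx nP]; split=> //; exact: PA.
Qed.

(** The mollifier is at least (4^N spike 0 / 2)^3 on the cube of half-side
    d 4^-N, whose volume is 8 d^3 4^(-3N): the powers of 4 cancel. *)
Lemma mollified_value_ge {R : realType} (gamma d : R) (u : R3 R -> R) (N : nat) :
  0 < gamma -> u \in Lfun (m3 gamma) 2%:E ->
  {ae m3 gamma, forall x, box (4 ^- N) x -> 1 <= u x} ->
  0 < d <= 1 -> (forall s, `|s| <= d -> @spike R 0 / 2 <= spike s) ->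
  (@spike R 0 / 2) ^+ 3 * (8 * d ^+ 3) <= \int[leb3 R]_x (u x * mollifier N 0 x).
Proof.
move=> g0 u2 uG /andP[d0 d1] spd.
set b := spike 0 / 2 in spd *.
have b0 : 0 < b by rewrite divr_gt0// spike0_gt0.
set r : R := 4 ^- N in uG *.
have r01 : 0 < r <= 1 by exact: inv4X_gt0_le1.
have [r0 r1] := andP r01.
have mmol : measurable_fun [set: R3 R] (mollifier N 0).
  by apply: measurable_tprod => j; exact: smooth_scaled_spike.
have mollifier_ge0 (x : R3 R) : 0 <= mollifier N 0 x.
  have s0 := @scaled_spike_ge0 R.
  exact: (mulr_ge0 (mulr_ge0 (s0 _ _) (s0 _ _)) (s0 _ _)).
have mu : measurable_fun [set: R3 R] u.
  by move: u2; rewrite inE => /andP[]; rewrite inE.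
(* Replacing u by its maximum with 1 changes nothing almost everywhere on the
   support of the mollifier, and makes the integrand nonnegative everywhere. *)
pose v x := Num.max (u x) 1 * mollifier N 0 x.
have mv : measurable_fun [set: R3 R] (EFin \o v).
  by apply/measurable_EFinP; apply: measurable_funM => //; exact: measurable_maxr.
have v0 x : 0 <= v x by rewrite mulr_ge0// le_max ler01 orbT.
have intE : (\int[leb3 R]_x (u x * mollifier N 0 x)%:E = \int[leb3 R]_x (v x)%:E)%E.
  apply: ae_eq_integral => //.
    by apply/measurable_EFinP; exact: measurable_funM.
  have [A [mA A0 HA]] := ae_leb3_of_ae_m3 _ _ _ g0 r01 uG.
  exists A; split=> // x /= nx; apply: HA => /= ux; apply: nx => _.
  rewrite /v; have [bx|nb] := pselect (box r x).
    by rewrite max_l// ux.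
  by rewrite mollifier_out// !mulr0.
have iu := integrable_mollifier gamma g0 u N 0 u2.
rewrite -lee_fin /Rintegral fineK; last exact: (integrable_fin_num measurableT iu).
rewrite intE.
pose K : R := (4 ^+ N * b) ^+ 3.
have mb := @measurable_box R (d * r).
have dr0 : 0 <= d * r by rewrite mulr_ge0// ltW.
apply: (@le_trans _ _ (\int[leb3 R]_(x in box (d * r)) K%:E)%E).
  rewrite integral_cst//.
  rewrite [X in (_ <= _ * X)%E](leb3_box _ dr0) -EFinM lee_fin /K /r.
  rewrite le_eqVlt; apply/orP; left; apply/eqP.
  have : (4 : R) ^+ N != 0 by rewrite gt_eqF ?exprn_gt0.
  by move: (4 ^+ N) => q q0; field.
apply: (@le_trans _ _ (\int[leb3 R]_(x in box (d * r)) (v x)%:E)%E); last first.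
  by apply: ge0_subset_integral => // x _; rewrite lee_fin.
apply: ge0_le_integral => //.
- by move=> x _; rewrite lee_fin exprn_ge0// mulr_ge0 ?exprn_ge0// ltW.
- exact: measurable_funTS.
move=> x /boxP[x1 x2 x3]; rewrite lee_fin.
have sp s : `|s| <= d * r -> 4 ^+ N * b <= scaled_spike N s.
  move=> sd; rewrite /scaled_spike ler_wpM2l ?exprn_ge0//; apply: spd.
  rewrite normrM ger0_norm ?exprn_ge0// -ler_pdivlMl ?exprn_gt0//.
  by rewrite mulrC.
have A0 : 0 <= 4 ^+ N * b by rewrite mulr_ge0 ?exprn_ge0// ltW.
apply: (@le_trans _ _ (1 * mollifier N 0 x)); last first.
  by rewrite ler_wpM2r// le_max lexx orbT.
rewrite mul1r /K (_ : _ ^+ 3 = (4 ^+ N * b) * (4 ^+ N * b) * (4 ^+ N * b)); last first.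
  by rewrite !exprS expr0 mulr1 mulrA.
apply: ler_pM => //; [exact: mulr_ge0|apply: ler_pM => //; exact: sp|exact: sp].
Qed.

Lemma box_sub_nbhs0 {R : realType} (G : set (R3 R)) :
  open G -> G 0 -> exists N, box (4 ^- N) `<=` G.
Proof.
move=> oG G0.
have /nbhs_ballP[e /= e0 eG] : nbhs (0 : R3 R) G by exact: open_nbhs_nbhs.
have [N Ne] : exists N, (4 ^- N : R) < e.
  exists (Num.bound e^-1).
  have h1 := archi_boundP (ltW (_ : 0 < e^-1)).
  rewrite -[ltRHS]invrK ltf_pV2 ?posrE ?invr_gt0 ?exprn_gt0//.
  apply: lt_le_trans (h1 _) _; first by rewrite invr_gt0.
  by rewrite -natrX ler_nat; apply: ltnW; apply: ltn_expl.
exists N => x /boxP[x1 x2 x3]; apply: eG.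
have lt (t : R) : `|t| <= 4 ^- N -> `|0 - t| < e.
  by rewrite sub0r normrN => /le_lt_trans; apply.
by split; [split|]; exact: lt.
Qed.

(** Compare the two bounds on the mollified value, c0 below and
    L (Lam c^-2 (|u|^2 + 2 |grad u|^2) + 56 / Lam) above. *)
Lemma formE1_lower_bound {R : realType} (gamma : R) : 0 < gamma ->
  exists2 eps : R, 0 < eps & forall (G : set (R3 R)) (u : R3 R -> R),
    open G -> G 0 -> domF gamma u ->
    {ae m3 gamma, forall x, G x -> 1 <= u x} -> eps <= formE1 gamma u u.
Proof.
move=> g0.
have [d d01 spd] := @spike_near0 R.
pose c0 : R := (@spike R 0 / 2) ^+ 3 * (8 * d ^+ 3).
pose L : R := 16 * spike_bound R ^+ 3.
pose c := psi_lb gamma.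
have cgt0 : 0 < c by exact: psi_lb_gt0.
have c00 : 0 < c0.
  have s0 : 0 < @spike R 0 / 2 by rewrite divr_gt0 ?spike0_gt0.
  have /andP[d0 _] := d01.
  apply: mulr_gt0; first exact: exprn_gt0.
  by apply: mulr_gt0 => //; exact: exprn_gt0.
have L0 : 0 < L by rewrite mulr_gt0// exprn_gt0// (lt_le_trans _ (spike_bound_ge1 R)).
(* This makes the constant term L * 56 / Lam equal to c0 / 2. *)
pose Lam := 112 * L / c0.
have Lam0 : 0 < Lam by rewrite divr_gt0// mulr_gt0.
exists (c0 * c ^+ 2 / (8 * L * Lam)).
  apply: divr_gt0; first by apply: mulr_gt0 => //; exact: exprn_gt0.
  by apply: mulr_gt0 => //; exact: mulr_gt0.
move=> G u oG G0 [u2 [g0' ug0] wg2] uG.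
have ug : is_weak_gradient u (wgrad u) by apply: xgetPex; exists g0'.
have [N NG] := box_sub_nbhs0 G oG G0.
have uN : {ae m3 gamma, forall x, box (4 ^- N) x -> 1 <= u x}.
  by apply: filterS uG => x H /NG.
have lo := mollified_value_ge gamma d u N g0 u2 uN d01 spd.
have hi := mollified_value_bound gamma g0 u (wgrad u) Lam N Lam0 u2 wg2 ug.
have E1 : formE1 gamma u u =
    2^-1 * \sum_(i < 3) \int[m3 gamma]_x (wgrad u i x * wgrad u i x) +
    \int[m3 gamma]_x (u x * u x).
  rewrite /formE1 /formE; congr (_ * _ + _).
  have iw i : (m3 gamma).-integrable [set: R3 R]
      (EFin \o (fun x => wgrad u i x * wgrad u i x)).
    exact: (Lfun2_integrable_sqr (wg2 i)).
  rewrite !big_ord_recl big_ord0 addr0.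
  under eq_Rintegral => x _ do rewrite !big_ord_recl big_ord0 addr0.
  rewrite RintegralD//; last first.
    exact: (@integrableD _ _ _ (m3 gamma) _ measurableT _ _ (iw _) (iw _)).
  by rewrite RintegralD.
have := le_trans lo (le_trans (ler_norm _) hi).
have D0 : 0 <= \sum_(i < 3) \int[m3 gamma]_x (wgrad u i x * wgrad u i x).
  by apply: sumr_ge0 => i _; apply: Rintegral_ge0 => x _; rewrite -expr2 sqr_ge0.
have E0 : 0 <= \int[m3 gamma]_x (u x * u x).
  by apply: Rintegral_ge0 => x _; rewrite -expr2 sqr_ge0.
move: D0 E0; rewrite E1 -/c0 -/L -/c.
move: (\sum_(i < 3) _) (\int[m3 gamma]_x (u x * u x)) => D E D0 E0.
have -> : L * (Lam / c ^+ 2 * (E + 2 * D) + 56 / Lam) =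
    L * Lam / c ^+ 2 * (E + 2 * D) + c0 / 2.
  by rewrite /Lam; field; rewrite !gt_eqF.
move=> h.
have LL : 0 < L * Lam / c ^+ 2 by apply: divr_gt0; [exact: mulr_gt0|exact: exprn_gt0].
have : L * Lam / c ^+ 2 * (E + 2 * D) <= L * Lam / c ^+ 2 * (4 * (2^-1 * D + E)).
  by rewrite ler_wpM2l ?(ltW LL)//; lra.
move=> h2.
have K0 : 0 < 8 * L * Lam by apply: mulr_gt0 => //; exact: mulr_gt0.
have c20 : 0 < c ^+ 2 by exact: exprn_gt0.
rewrite (ler_pdivrMr _ _ K0) -(ler_pdivlMr _ _ c20).
have -> : (2^-1 * D + E) * (8 * L * Lam) / c ^+ 2 =
    2 * (L * Lam / c ^+ 2 * (4 * (2^-1 * D + E))).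
  by field; rewrite gt_eqF.
lra.
Qed.

Theorem proposition3p1 (R : realType) (gamma : R) (gamma_gt0 : 0 < gamma) :
  (0 < Cap gamma [set 0%R])%E.
Proof.
have [eps eps0 H] := formE1_lower_bound gamma gamma_gt0.
apply: (@lt_le_trans _ _ eps%:E); first by rewrite lte_fin.
apply: le_ereal_inf_tmp => _ [G [oG G0] <-].
apply: le_ereal_inf_tmp => _ [u [du uG] <-].
by rewrite lee_fin; apply: (H G) => //; exact: G0.
Qed.
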